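(* Let $G$ be a (discrete) group, $q\colon(K;\varphi)\to(L;\psi)$ an extension of topological dynamical systems and $\mu_L\in\mathrm{P}^\psi(L)$ a fully supported invariant measure. The canonical map $$\int_L\mathrm{d}\mu_L\colon\mathrm{RIM}(q)\to\{\mu_K\in\mathrm{P}^\varphi(K):q_*\mu_K=\mu_L\},\quad\nu\mapsto\int_L\nu\,\mathrm{d}\mu_L,$$ with $(\int_L\nu\,\mathrm{d}\mu_L)(f)=\int_L\nu_l(f)\,\mathrm{d}\mu_L(l)$ for $f\in\mathrm{C}(K)$ and $\nu\in\mathrm{RIM}(q)$, is (i) injective, and (ii) bijective if $\mu_L$ is normal.
   Context: All compact spaces are Hausdorff; $G$ is a fixed group with the discrete topology. A topological dynamical system $(K;\varphi)$ is a compact space $K$ with a group homomorphism $\varphi\colon G\to\mathrm{Homeo}(K)$, $t\mapsto\varphi_t$. An extension $q\colon(K;\varphi)\to(L;\psi)$ is a continuous surjection $q\colon K\to L$ with $q\circ\varphi_t=\psi_t\circ q$ for all $t$. $\mathrm{P}(K)$ is the set of regular Borel probability measures on $K$, with the weak* topology, and $\mu(f)=\int f\,\mathrm{d}\mu$; $\mathrm{P}^\varphi(K)=\{\mu\in\mathrm{P}(K):(\varphi_t)_*\mu=\mu\ \forall t\in G\}$. $\mathrm{P}_q(K)\subseteq\mathrm{P}(K)$ is the subspace of measures whose push-forward under $q$ is a point measure. $\mathrm{RIM}(q)$ is the set of relatively invariant measures for $q$: continuous maps $\nu\colon L\to\mathrm{P}_q(K)$, $l\mapsto\nu_l$, with $q_*\nu_l=\delta_l$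 and $(\varphi_t)_*\nu_l=\nu_{\psi_t(l)}$ for all $l\in L$, $t\in G$. A measure $\mu_L\in\mathrm{P}(L)$ is fully supported if its support is $L$, and normal if the canonical map $\mathrm{C}(L)\to\mathrm{L}^\infty(L,\mu_L)$ is a bijection. *)

(* Defs.v *)
From HB Require Import structures.
From mathcomp Require Import all_boot all_order all_algebra.
From mathcomp Require Import all_classical all_reals all_analysis.

Set Implicit Arguments.
Unset Strict Implicit.
Unset Printing Implicit Defensive.

Import Order.TTheory GRing.Theory Num.Theory.
Import numFieldTopology.Exports numFieldNormedType.Exports.

Local Open Scope classical_set_scope.
Local Open Scope ring_scope.

Definition homeomorphism (X Y : topologicalType) (f : X -> Y) : Prop :=
  continuous f /\ exists g : Y -> X, [/\ continuous g, cancel f g & cancel g f].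

(* A homomorphism [phi] from [G] to the group of homeomorphisms of [K]; the
   discrete topology on [G] imposes no condition. *)
Definition top_dyn_system (G : groupType) (K : ptopologicalType)
    (phi : G -> K -> K) : Prop :=
  [/\ compact [set: K], hausdorff_space K,
      forall t, homeomorphism (phi t),
      phi 1%g = id &
      forall s t, phi (s * t)%g = phi s \o phi t].

Definition is_extension (G : groupType) (K L : ptopologicalType)
    (phi : G -> K -> K) (psi : G -> L -> L) (q : K -> L) : Prop :=
  [/\ top_dyn_system phi, top_dyn_system psi, continuous q,
      set_surj [set: K] [set: L] q &
      forall t, q \o phi t = psi t \o q].

Definition borel (K : ptopologicalType) : measurableType (@open K).-sigma :=
  g_sigma_algebraType (@open K).

(* The carrier of a library measure is a function on all subsets, so equality
   of measures has to be tested on Borel sets only. *)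
Definition eq_borel (R : realType) (K : ptopologicalType)
    (m1 m2 : set (borel K) -> \bar R) : Prop :=
  forall A : set (borel K), measurable A -> m1 A = m2 A.

Notation "m1 ≡B m2" := (eq_borel m1 m2) (at level 70).

Definition regular_borel (R : realType) (K : ptopologicalType)
    (m : set (borel K) -> \bar R) : Prop :=
  forall A : set (borel K), measurable A ->
    m A = ereal_inf [set m U | U in [set U : set K | open U /\ A `<=` U]] /\
    m A = ereal_sup [set m C | C in [set C : set K | compact C /\ C `<=` A]].

(* The last field fixes the irrelevant values on non-Borel sets, so that
   Leibniz equality on [Prob R K] is equality of measures ([Prob_eq]), at no
   loss of generality ([Prob_exists]). *)
Record Prob (R : realType) (K : ptopologicalType) := MkProb {
  Prob_prob :> probability (borel K) R ;
  Prob_regular : regular_borel Prob_prob ;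
  Prob_nonborel :
    forall A : set (borel K), ~ measurable A -> Prob_prob A = 0%E }.

Lemma Prob_eq (R : realType) (K : ptopologicalType) (m1 m2 : Prob R K) :
  m1 ≡B m2 <-> m1 = m2.
Proof.
split=> [e|-> //].
have {e} : (m1 : set (borel K) -> \bar R) = m2.
  apply/funext => A; have [mA|nA] := pselect (measurable A); first exact: e.
  by rewrite !Prob_nonborel.
case: m1 m2 => [p1 r1 n1] [p2 r2 n2] /= e.
suff e' : p1 = p2 by subst p2; congr MkProb; exact: Prop_irrelevance.
move: p1 p2 e {r1 n1 r2 n2} => [f1 [[a1 b1] [c1] [d1] [g1] [h1] [i1] [j1]]].
move=> [f2 [[a2 b2] [c2] [d2] [g2] [h2] [i2] [j2]]] /= e; subst f2.
rewrite (Prop_irrelevance a1 a2) (Prop_irrelevance b1 b2).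
rewrite (Prop_irrelevance c1 c2) (Prop_irrelevance d1 d2).
rewrite (Prop_irrelevance g1 g2) (Prop_irrelevance h1 h2).
by rewrite (Prop_irrelevance i1 i2) (Prop_irrelevance j1 j2).
Qed.

Section Prob_exists.
Context (R : realType) (K : ptopologicalType) (m : probability (borel K) R).

Definition Probfun (A : set (borel K)) : \bar R :=
  if `[< measurable A >] then m A else 0%E.

Lemma ProbfunE A : measurable A -> Probfun A = m A.
Proof. by move=> mA; rewrite /Probfun asboolT. Qed.

Let Probfun0 : Probfun set0 = 0%E.
Proof. by rewrite ProbfunE. Qed.

Let Probfun_ge0 A : (0 <= Probfun A)%E.
Proof. by rewrite /Probfun; case: ifP. Qed.

Let Probfun_semi_sigma_additive : semi_sigma_additive Probfun.
Proof.
move=> F mF tF mUF; rewrite ProbfunE//.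
rewrite (_ : (fun n => _) = fun n => (\sum_(0 <= i < n) m (F i))%E).
  exact: measure_semi_sigma_additive.
by apply/funext => n; apply: eq_bigr => i _; rewrite ProbfunE.
Qed.

HB.instance Definition _ := isMeasure.Build _ _ _ Probfun
  Probfun0 Probfun_ge0 Probfun_semi_sigma_additive.

Let ProbfunT : Probfun [set: borel K] = 1%E.
Proof. by rewrite ProbfunE// probability_setT. Qed.

HB.instance Definition _ := Measure_isProbability.Build _ _ _ Probfun ProbfunT.

Lemma Prob_exists :
  hausdorff_space K -> regular_borel m -> exists mu : Prob R K, mu ≡B m.
Proof.
move=> hK rm.
have rP : regular_borel Probfun.
  move=> A mA; rewrite ProbfunE//; have [hi hs] := rm A mA; split.
    rewrite hi; congr ereal_inf; apply: eq_imagel => U [oU _].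
    by rewrite ProbfunE//; exact: sub_sigma_algebra.
  rewrite hs; congr ereal_sup; apply: eq_imagel => C [cC _].
  rewrite ProbfunE// -(setCK C); apply: measurableC.
  by apply: sub_sigma_algebra; apply: closed_openC; exact: compact_closed.
have nP A : ~ measurable A -> Probfun A = 0%E.
  by move=> nA; rewrite /Probfun asboolF.
by exists (MkProb rP nP) => A mA /=; rewrite ProbfunE.
Qed.
End Prob_exists.

HB.instance Definition _ (R : realType) (K : ptopologicalType) :=
  gen_eqMixin (Prob R K).
HB.instance Definition _ (R : realType) (K : ptopologicalType) :=
  gen_choiceMixin (Prob R K).

Definition Prob_eval (R : realType) (K : ptopologicalType) (mu : Prob R K) :
    {ptws continuousType K R -> R} :=
  fun f => \int[mu]_x f x.

(* the weak* topology *)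
HB.instance Definition _ (R : realType) (K : ptopologicalType) :=
  Topological.copy (Prob R K) (initial_topology (@Prob_eval R K)).

Definition invariant_measures (R : realType) (G : groupType)
    (K : ptopologicalType) (phi : G -> K -> K) : set (Prob R K) :=
  [set mu : Prob R K |
    forall t, pushforward mu (phi t : borel K -> borel K) ≡B mu].

Definition Prob_fiber (R : realType) (K L : ptopologicalType) (q : K -> L) :
    set (Prob R K) :=
  [set mu : Prob R K | exists l : L,
    pushforward mu (q : borel K -> borel L) ≡B \d_(l : borel L)].

Definition RIM (R : realType) (G : groupType) (K L : ptopologicalType)
    (phi : G -> K -> K) (psi : G -> L -> L) (q : K -> L) :
    set (L -> Prob R K) :=
  [set nu : L -> Prob R K |
    [/\ forall l, Prob_fiber q (nu l),
        continuous nu,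
        forall l, pushforward (nu l) (q : borel K -> borel L)
                    ≡B \d_(l : borel L) &
        forall t l, pushforward (nu l) (phi t : borel K -> borel K)
                      ≡B nu (psi t l)]].

Arguments RIM R {G K L} phi psi q.

Definition invariant_lifts (R : realType) (G : groupType)
    (K L : ptopologicalType) (phi : G -> K -> K) (q : K -> L) (muL : Prob R L) :
    set (Prob R K) :=
  [set muK : Prob R K | invariant_measures phi muK /\
    pushforward muK (q : borel K -> borel L) ≡B muL].

Definition msupport (R : realType) (L : ptopologicalType) (mu : Prob R L) :
    set L :=
  [set x | forall U : set L, open U -> U x -> (0 < mu U)%E].

Definition fully_supported (R : realType) (L : ptopologicalType) (mu : Prob R L) :
    Prop :=
  msupport mu = [set: L].

Section normal_measure.
Context (R : realType) (L : ptopologicalType) (mu : Prob R L).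

Definition Linfty := LspaceType mu (leey 1%E : (1 <= +oo :> \bar R)%E).

Section canonical_map.
Context (cL : compact [set: L]) (f : continuousType L R).

Definition Cfun : borel L -> measurableTypeR R := f.

Let measurable_Cfun : measurable_fun [set: borel L] Cfun.
Proof.
apply: (measurability _ (measurable_realfun.RGenOInfty.measurableE R)) => //.
move=> _ [_ [a ->] <-].
rewrite setTI; apply: sub_sigma_algebra.
apply: (open_comp (f := f)) => [x _|]; first exact: cts_fun.
exact: interval_open.
Qed.

HB.instance Definition _ := isMeasurableFun.Build _ _ _ _ Cfun measurable_Cfun.

Definition Cclass : {mfun_ mu, borel L >-> measurableTypeR R} :=
  (\pi_({mfun_ mu, borel L >-> measurableTypeR R}) Cfun)%qT.

Let finite_norm_Cclass : finite_norm mu +oo%E (Cclass : borel L -> R).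
Proof.
rewrite /finite_norm unlock /=.
have -> : mu [set: borel L] = 1%E by exact: probability_setT.
rewrite lte01.
have /compact_bounded[M [_ fM]] : compact (f @` [set: L]).
  apply: continuous_compact => //; apply: continuous_subspaceT.
  exact: cts_fun.
apply: (@le_lt_trans _ _ (M + 1)%:E); last exact: ltry.
apply/ess_sup_inf.ess_supP.
have /eqmodP/asboolP : (repr Cclass = Cfun %[mod {mfun_ mu, borel L >->
  measurableTypeR R}])%qT by exact: reprK.
apply: filterS => x /(_ I) /= e; rewrite /Cclass /aqEqMfun_to_fun e lee_fin.
by apply: (fM (M + 1)); [rewrite ltrDl|exists x].
Qed.

HB.instance Definition _ :=
  isFinLebesgue.Build _ _ _ mu _ (leey 1%E) Cclass finite_norm_Cclass.

Definition C_to_Linfty : Linfty := Cclass.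
End canonical_map.

(* Compactness of [L] only serves to make the class of a continuous function
   essentially bounded. *)
Definition normal_measure : Prop :=
  exists cL : compact [set: L], bijective (C_to_Linfty cL).

End normal_measure.

(* [muK] is the measure $\int_L \nu d\mu_L$, tested on real-valued continuous
   functions. *)
Definition is_integral_of (R : realType) (K L : ptopologicalType)
    (muL : Prob R L) (nu : L -> Prob R K) (muK : Prob R K) : Prop :=
  forall f : continuousType K R,
    \int[muK]_x f x = \int[muL]_l \int[nu l]_x f x.

(* Main.v *)
Require Import Defs.
From HB Require Import structures.
From mathcomp Require Import all_boot all_order all_algebra.
From mathcomp Require Import all_classical all_reals all_analysis.
From mathcomp Require Import measurable_realfun ring lra.

Set Implicit Arguments.
Unset Strict Implicit.
Unset Printing Implicit Defensive.

Import Order.TTheory GRing.Theory Num.Theory.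
Import numFieldTopology.Exports numFieldNormedType.Exports.

Local Open Scope classical_set_scope.
Local Open Scope ring_scope.

(** Let [nu] be a relatively invariant measure and [muK] its integral. Since
    [nu l] lives on the fibre over [l], every continuous [f] on [K] and [g] on
    [L] satisfy
      $\int g(l) \nu_l(f) d\mu_L = \int f (g \circ q) d\mu_K$,
    so the continuous function $l \mapsto \nu_l(f)$ is the conditional
    expectation of [f] on [L]. Because [muL] has full support, a continuous
    function on [L] is determined by its integrals against continuous functions
    ([full_support_uniq]); hence [muK] determines all the numbers $\nu_l(f)$ and
    with them [nu] ([RIM_integral_inj]).

    Conversely let [muK] be an invariant lift and [muL] normal. The functional
    $g \mapsto \int f (g \circ q) d\mu_K$ is integration against a measure
    dominated by a multiple of [muL]; its density is bounded, and by normality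
    it has a continuous representative $E(f)$ ([cond_exp_exists]). Uniqueness makes
    $E$ linear, positive, unital and equivariant on continuous functions, not
    just almost everywhere, so that every $f \mapsto E(f)(l)$ is given by a
    measure $\nu_l$. The module property $E(g \circ q) = g$ says that $\nu_l$
    projects to the point mass at [l] ([disintegration]).

    Both halves, and the existence of the integral itself, turn functionals on
    continuous functions into measures, by the Riesz representation theorem
    ([riesz_representation]) for regular Borel measures on a compact Hausdorff
    space. It is obtained from the outer measure generated by
    $\lambda(U) = \sup \{I(h) : 0 \leq h \leq 1_U\}$ on open sets. Equalities
    between measures, such as invariance, are always checked on continuous
    functions, which suffices by regularity ([regular_uniq], [image_eqP]). *)

(** * Continuous real functions *)

Section continuous_functions.
Context (R : realType) (T : topologicalType).
Implicit Types f g : T -> R.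

Lemma ctsD f g :
  continuous f -> continuous g -> continuous (fun x => f x + g x).
Proof. by move=> cf cg x; exact: continuousD (cf x) (cg x). Qed.

Lemma ctsM f g :
  continuous f -> continuous g -> continuous (fun x => f x * g x).
Proof. by move=> cf cg x; exact: continuousM (cf x) (cg x). Qed.

Lemma cts_const (a : R) : continuous ((fun=> a) : T -> R).
Proof. by move=> x; exact: cvg_cst. Qed.

Lemma ctsZ a f : continuous f -> continuous (fun x => a * f x).
Proof. by move=> cf; apply: ctsM => //; exact: cts_const. Qed.

Lemma ctsB f g :
  continuous f -> continuous g -> continuous (fun x => f x - g x).
Proof. by move=> cf cg x; exact: continuousB (cf x) (cg x). Qed.

Lemma cts_max f g :
  continuous f -> continuous g -> continuous (fun x => Num.max (f x) (g x)).
Proof. by move=> cf cg x; exact: continuous_max (cf x) (cg x). Qed.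

Lemma cts_min f g :
  continuous f -> continuous g -> continuous (fun x => Num.min (f x) (g x)).
Proof. by move=> cf cg x; exact: continuous_min (cf x) (cg x). Qed.

Lemma cts_comp (U : topologicalType) (h : U -> T) f :
  continuous h -> continuous f -> continuous (fun x => f (h x)).
Proof. by move=> ch cf x; exact: (continuous_comp (ch x) (cf _)). Qed.

Lemma closed_ge_cts f a : continuous f -> closed [set x | a <= f x].
Proof. by move=> /continuous_closedP cf; exact: cf (@closed_ge R a). Qed.

Lemma open_gt_cts f a : continuous f -> open [set x | a < f x].
Proof. by move=> /continuousP cf; exact: cf (@open_gt R a). Qed.

Lemma cts_bounded f : compact [set: T] -> continuous f ->
  exists2 M, 0 < M & forall x, `|f x| <= M.
Proof.
move=> cT cf.
have /compact_bounded[M [_ fM]] : compact (f @` [set: T]).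
  by apply: continuous_compact => //; exact: continuous_subspaceT.
exists (`|M| + 1) => [|x]; first by rewrite ltr_wpDl.
by apply: fM; [rewrite (le_lt_trans (ler_norm M))// ltrDl|exists x].
Qed.

Lemma urysohn_compact (A U : set T) :
  compact [set: T] -> hausdorff_space T -> closed A -> open U -> A `<=` U ->
  exists f, [/\ continuous f, forall x, 0 <= f x <= 1,
    forall x, A x -> f x = 1 & forall x, ~ U x -> f x = 0].
Proof.
move=> cT hT clA oU AU.
have nT : normal_space T by exact: compact_normal.
have : uniform_separator (~` U) A.
  apply: (@normal_separatorP R T).1 => //; first exact: open_closedC.
  by apply/seteqP; split => // x [/= nU /AU].
move=> /(@uniform_separatorP T R)[f [cf f01 f0 f1]].
exists f; split => // x.
- by have := f01 (f x); rewrite /= in_itv/=; apply; exists x.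
- by move=> Ax; apply: f1; exists x.
- by move=> Ux; apply: f0; exists x.
Qed.

End continuous_functions.

(** * Borel sets and positive functionals *)

Section borel.
Context (K L : ptopologicalType).

Lemma measurable_open (U : set K) : open U -> measurable (U : set (borel K)).
Proof. exact: sub_sigma_algebra. Qed.

Lemma measurable_closed (C : set K) : closed C -> measurable (C : set (borel K)).
Proof.
move=> cC; rewrite -(setCK C); apply: measurableC.
by apply: measurable_open; exact: closed_openC.
Qed.

Lemma cts_measurable_borel (q : K -> L) :
  continuous q -> measurable_fun [set: borel K] (q : borel K -> borel L).
Proof.
move=> cq; apply: (@measurability _ _ (borel K) (borel L) _ _ (@open L)) => //.
move=> _ [U oU <-]; rewrite setTI; apply: measurable_open.
by apply: (open_comp (f := q)) => // x _; exact: cq.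
Qed.

Lemma cts_measurable (R : realType) (f : K -> R) :
  continuous f -> measurable_fun [set: borel K] (f : borel K -> R).
Proof.
move=> cf.
apply: (measurability _ (measurable_realfun.RGenOInfty.measurableE R)) => //.
move=> _ [_ [a ->] <-]; rewrite setTI; apply: measurable_open.
by apply: (open_comp (f := f)) => [x _|]; [exact: cf|exact: interval_open].
Qed.

End borel.

(** States are taken on all real functions and constrained on the continuous ones
    only, so that integrals are states as they stand. *)
Definition state (R : realType) (K : topologicalType) (I : (K -> R) -> R) :=
  [/\ forall f g : K -> R, continuous f -> continuous g ->
        I (fun x => f x + g x) = I f + I g,
      forall (a : R) (f : K -> R), continuous f ->
        I (fun x => a * f x) = a * I f,
      forall f : K -> R, continuous f -> (forall x, 0 <= f x) -> 0 <= I f &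
      I (fun=> 1) = 1].

Section state_theory.
Context (R : realType) (K : topologicalType) (I : (K -> R) -> R).
Hypothesis stI : state I.
Implicit Types f g : K -> R.

Lemma stateD f g : continuous f -> continuous g ->
  I (fun x => f x + g x) = I f + I g.
Proof. by case: stI => + _ _ _; exact. Qed.

Lemma stateZ a f : continuous f -> I (fun x => a * f x) = a * I f.
Proof. by case: stI => _ + _ _; exact. Qed.

Lemma state_ge0 f : continuous f -> (forall x, 0 <= f x) -> 0 <= I f.
Proof. by case: stI => _ _ + _; exact. Qed.

Lemma state_cst a : I (fun=> a) = a.
Proof.
case: stI => _ hZ _ h1; rewrite -[in LHS](mulr1 a) (hZ a) ?h1 ?mulr1//.
exact: cts_const.
Qed.

Lemma stateB f g : continuous f -> continuous g ->
  I (fun x => f x - g x) = I f - I g.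
Proof.
move=> cf cg; rewrite (_ : (fun x => _) = fun x => f x + (-1) * g x).
  by rewrite stateD ?stateZ ?mulN1r//; exact: ctsZ.
by apply/funext => x; rewrite mulN1r.
Qed.

Lemma le_state f g : continuous f -> continuous g ->
  (forall x, f x <= g x) -> I f <= I g.
Proof.
move=> cf cg fg; rewrite -subr_ge0 -stateB//.
by apply: state_ge0 => [|x]; [exact: ctsB|rewrite subr_ge0].
Qed.

Lemma state_sum (n : nat) (f : nat -> K -> R) :
  (forall i, continuous (f i)) ->
  I (fun x => \sum_(i < n) f i x) = \sum_(i < n) I (f i).
Proof.
move=> cf; elim: n => [|n IH].
  rewrite big_ord0 -[RHS](state_cst 0); congr I.
  by apply/funext => x; rewrite big_ord0.
rewrite big_ord_recr/= -IH -stateD//; last first.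
  elim: n {IH} => [|n IH].
    rewrite (_ : (fun x => _) = fun=> 0); first exact: cts_const.
    by apply/funext => x; rewrite big_ord0.
  rewrite (_ : (fun x => _) = fun x => (\sum_(i < n) f i x) + f n x).
    exact: ctsD.
  by apply/funext => x; rewrite big_ord_recr.
by congr I; apply/funext => x; rewrite big_ord_recr.
Qed.

End state_theory.

Section integral_state.
Context (R : realType) (K : ptopologicalType) (mu : probability (borel K) R).
Hypothesis cK : compact [set: K].

Lemma bounded_integrable (f : borel K -> R) (M : R) :
  measurable_fun [set: borel K] f -> (forall x, `|f x| <= M) ->
  mu.-integrable [set: borel K] (EFin \o f).
Proof.
move=> mf fM; apply: measurable_bounded_integrable => //.
  by rewrite (le_lt_trans (probability_le1 mu _))// ltry.
exists M; split; first exact: num_real.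
by move=> y My x _ /=; apply: (le_trans (fM x)); exact: ltW.
Qed.

Lemma cts_integrable (f : K -> R) : continuous f ->
  mu.-integrable [set: borel K] (EFin \o (f : borel K -> R)).
Proof.
move=> cf; have [M _ fM] := cts_bounded cK cf.
by apply: (@bounded_integrable _ M) => //; exact: cts_measurable.
Qed.

Lemma integral_state : state (fun f : K -> R => \int[mu]_x f x).
Proof.
split=> [f g cf cg|a f cf|f cf f0|].
- by rewrite RintegralD//; exact: cts_integrable.
- by rewrite RintegralZl//; exact: cts_integrable.
- by apply: Rintegral_ge0 => x _; exact: f0.
- rewrite Rintegral_cst// mul1r.
  exact: (congr1 fine (probability_setT mu)).
Qed.

Lemma Rintegral_indic (A : set (borel K)) : measurable A ->
  \int[mu]_x \1_A x = fine (mu A).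
Proof. by move=> mA; rewrite /Rintegral integral_indic// setIT. Qed.

Lemma le_measure_integral (A : set (borel K)) (f : K -> R) :
  measurable A -> continuous f -> (forall x, \1_A x <= f x) ->
  (mu A <= (\int[mu]_x f x)%:E)%E.
Proof.
move=> mA cf Af; rewrite -(fineK (fin_num_measure mu _ mA)) lee_fin.
rewrite -Rintegral_indic//; apply: le_Rintegral => //.
- apply: (@bounded_integrable _ 1) => // x.
  by rewrite indicE ger0_norm//; case: (_ \in _).
- exact: cts_integrable.
Qed.

Lemma le_integral_measure (A : set (borel K)) (f : K -> R) :
  measurable A -> continuous f -> (forall x, f x <= \1_A x) ->
  ((\int[mu]_x f x)%:E <= mu A)%E.
Proof.
move=> mA cf Af; rewrite -(fineK (fin_num_measure mu _ mA)) lee_fin.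
rewrite -Rintegral_indic//; apply: le_Rintegral => //.
- exact: cts_integrable.
- apply: (@bounded_integrable _ 1) => // x.
  by rewrite indicE ger0_norm//; case: (_ \in _).
Qed.

End integral_state.

(** * Regular measures are determined by continuous functions *)

Section regular.
Context (R : realType) (K : ptopologicalType).
Hypotheses (cK : compact [set: K]) (hK : hausdorff_space K).

Lemma compact_closedE (C : set K) : compact C <-> closed C.
Proof.
split=> [|clC]; first exact: compact_closed.
exact: (subclosed_compact clC cK).
Qed.

(** Inner regularity of [m1] and Urysohn's lemma squeeze a function between a
    compact set and an open set containing it, which compares [m1] and [m2] on
    open sets; outer regularity of [m2] does the rest. *)
Lemma regular_le (m1 m2 : probability (borel K) R) (M : R) : 0 < M ->
  regular_borel m1 -> regular_borel m2 ->
  (forall f : K -> R, continuous f -> (forall x, 0 <= f x) ->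
    \int[m1]_x f x <= M * \int[m2]_x f x) ->
  forall A : set (borel K), measurable A -> (m1 A <= M%:E * m2 A)%E.
Proof.
move=> M0 r1 r2 le12.
have le_open (U : set K) : open U -> (m1 U <= M%:E * m2 U)%E.
  move=> oU; have mU := measurable_open oU.
  rewrite (r1 U mU).2; apply: ge_ereal_sup => _ [C [cC CU] <-].
  have clC := (compact_closedE C).1 cC.
  have [f [cf f01 f1 f0]] := @urysohn_compact R K C U cK hK clC oU CU.
  apply: (@le_trans _ _ (\int[m1]_x f x)%:E).
    apply: le_measure_integral => //; first exact: measurable_closed.
    move=> x; rewrite indicE; case: (boolP (x \in C)) => [/set_mem/f1->//|_].
    by case/andP: (f01 x).
  apply: (@le_trans _ _ (M * \int[m2]_x f x)%:E).
    by rewrite lee_fin le12// => x; case/andP: (f01 x).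
  rewrite EFinM lee_pmul2l ?lte_fin//; apply: le_integral_measure => // x.
  rewrite indicE; case: (boolP (x \in U)) => [_|/negP Ux].
    by case/andP: (f01 x).
  by rewrite f0// => /mem_set.
move=> A mA; rewrite -lee_pdivrMl// (r2 A mA).1.
apply: le_ereal_inf_tmp => _ [U [oU AU] <-].
rewrite lee_pdivrMl//; apply: (le_trans _ (le_open U oU)).
apply: le_measure; rewrite ?inE//; exact: measurable_open.
Qed.

Lemma regular_uniq (m1 m2 : probability (borel K) R) :
  regular_borel m1 -> regular_borel m2 ->
  (forall f : K -> R, continuous f -> \int[m1]_x f x = \int[m2]_x f x) ->
  m1 ≡B m2.
Proof.
move=> r1 r2 e A mA; apply/eqP.
rewrite eq_le -[leRHS]mul1e -[X in _ && (_ <= X)%E]mul1e.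
by rewrite !regular_le// => f cf _; rewrite mul1r e.
Qed.

(** Inner regularity on Borel sets gives outer regularity by complements. *)
Lemma regular_borelP (m : probability (borel K) R) :
  (forall A : set (borel K), measurable A -> forall e : R, 0 < e ->
     exists2 C : set K, closed C /\ C `<=` A & (m A <= m C + e%:E)%E) ->
  regular_borel m.
Proof.
move=> inner A mA; split; apply/eqP; rewrite eq_le; apply/andP; split.
- apply: le_ereal_inf_tmp => _ [U [oU AU] <-]; apply: le_measure; rewrite ?inE//.
  exact: measurable_open.
- apply/lee_addgt0Pr => e e0.
  have [C [clC CA] mC] := inner _ (measurableC mA) e e0.
  have mmC := measurable_closed clC.
  apply: (@le_trans _ _ (m (~` C))).
    apply: ereal_inf_lbound; exists (~` C) => //; split.
      exact: closed_openC.
    by move=> x Ax /CA.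
  move: mC; rewrite !probability_setC//.
  rewrite -(fineK (fin_num_measure m _ mmC)) -(fineK (fin_num_measure m _ mA)).
  by rewrite -!EFinB -!EFinD !lee_fin; lra.
- apply/lee_addgt0Pr => e e0.
  have [C [clC CA] mC] := inner _ mA e e0.
  apply: (le_trans mC); rewrite leeD2r//; apply: ereal_sup_ubound; exists C => //.
  by split=> //; apply/compact_closedE.
- apply: ge_ereal_sup => _ [C [cC CA] <-]; apply: le_measure; rewrite ?inE//.
  by apply: measurable_closed; apply/compact_closedE.
Qed.

Lemma regular_inner (m : probability (borel K) R) : regular_borel m ->
  forall A : set (borel K), measurable A -> forall e : R, 0 < e ->
     exists2 C : set K, closed C /\ C `<=` A & (m A <= m C + e%:E)%E.
Proof.
move=> rm A mA e e0.
have := (rm A mA).2; set S := [set m C | C in _] => mAE.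
have Sfin : ereal_sup S \is a fin_num by rewrite -mAE; exact: fin_num_measure.
have [_ [C [cC CA] <-] lC] := ub_ereal_sup_adherent e0 Sfin.
exists C; first by split=> //; apply/compact_closedE.
by rewrite mAE -leeBlDr//; exact: ltW.
Qed.

End regular.

(** * The Riesz representation theorem *)

Section riesz.
Context (R : realType) (K : ptopologicalType) (I : (K -> R) -> R).
Hypotheses (cK : compact [set: K]) (hK : hausdorff_space K) (stI : state I).
Implicit Types (U V : set K) (g h : K -> R).

Definition below U : set (K -> R) :=
  [set h : K -> R | continuous h /\ forall x, 0 <= h x <= \1_U x].

Definition inner_content U : \bar R := ereal_sup [set (I h)%:E | h in below U].

Definition riesz_outer (A : set K) : \bar R :=
  ereal_inf [set inner_content U | U in [set U | open U /\ A `<=` U]].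

Definition trunc (e : R) h : K -> R := fun x => Num.max (h x - e) 0.

Lemma belowP U h : continuous h -> (forall x, 0 <= h x <= 1) ->
  (forall x, ~ U x -> h x = 0) -> below U h.
Proof.
move=> ch h01 hU; split=> // x; rewrite indicE.
case: (boolP (x \in U)) => [_|/negP Ux]; first exact: h01.
by rewrite hU ?lexx// => /mem_set.
Qed.

Lemma below_le1 U h : below U h -> forall x, 0 <= h x <= 1.
Proof.
by move=> [_ hU] x; have /andP[-> hx] := hU x; rewrite (le_trans hx).
Qed.

Lemma below_out U h : below U h -> forall x, ~ U x -> h x = 0.
Proof.
move=> [_ hU] x Ux; have := hU x.
by rewrite indicE memNset// => h0; apply/esym/le_anti.
Qed.

Lemma below_cst0 U : below U (fun=> 0).
Proof. by apply: belowP => // [|x]; [exact: cts_const|rewrite lexx ler01]. Qed.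

Lemma below_state U h : below U h -> 0 <= I h <= 1.
Proof.
move=> bh; have h1 := below_le1 bh; have ch := bh.1.
apply/andP; split; first by apply: (state_ge0 stI) => // x; case/andP: (h1 x).
rewrite -[leRHS](state_cst stI 1); apply: (le_state stI) => //.
  exact: cts_const.
by move=> x; case/andP: (h1 x).
Qed.

Lemma inner_content_ub U h : below U h -> ((I h)%:E <= inner_content U)%E.
Proof. by move=> bh; apply: ereal_sup_ubound; exists h. Qed.

Lemma inner_content_ge0 U : (0 <= inner_content U)%E.
Proof.
apply: le_trans (inner_content_ub (below_cst0 U)).
by rewrite (state_cst stI).
Qed.

Lemma inner_content_le1 U : (inner_content U <= 1)%E.
Proof.
by apply: ge_ereal_sup => _ [h /below_state/andP[_ h1] <-]; rewrite lee_fin.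
Qed.

Lemma inner_content_fin U : inner_content U \is a fin_num.
Proof.
rewrite ge0_fin_numE ?inner_content_ge0//.
by rewrite (le_lt_trans (inner_content_le1 U))// ltry.
Qed.

Lemma inner_content_setT : inner_content setT = 1%E.
Proof.
apply/eqP; rewrite eq_le inner_content_le1/=.
rewrite -[leLHS]/(1%:E) -[in leLHS](state_cst stI 1).
apply: inner_content_ub; apply: belowP => [|x|x []//]; first exact: cts_const.
by rewrite ler01 lexx.
Qed.

Lemma inner_content_adherent U (e : R) : 0 < e ->
  exists2 h, below U h & (inner_content U <= (I h + e)%:E)%E.
Proof.
move=> e0.
have [_ [h bh <-] lh] := ub_ereal_sup_adherent e0 (inner_content_fin U).
by exists h => //; rewrite EFinD -leeBlDr//; exact: ltW.
Qed.

Lemma le_inner_content U V : U `<=` V -> (inner_content U <= inner_content V)%E.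
Proof.
move=> UV; apply: ge_ereal_sup => _ [h bh <-]; apply: inner_content_ub.
apply: belowP; [exact: bh.1|exact: below_le1 bh|].
by move=> x Vx; apply: (below_out bh) => /UV.
Qed.

Lemma cts_trunc e h : continuous h -> continuous (trunc e h).
Proof.
by move=> ch; apply: cts_max; [apply: ctsB => //|]; exact: cts_const.
Qed.

(** Truncation localizes [h] to the closed, hence compact, set where [h] is at
    least [e], at a cost of at most [e]. *)
Lemma below_trunc U V e h : below U h -> 0 < e -> [set x | e <= h x] `<=` V ->
  below V (trunc e h).
Proof.
move=> bh e0 hV; apply: belowP; first exact: cts_trunc bh.1.
  move=> x; rewrite /trunc le_max lexx orbT/= ge_max ler01 andbT.
  by rewrite lerBlDr (le_trans (proj2 (andP (below_le1 bh x))))// lerDl ltW.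
move=> x Vx; rewrite /trunc max_r// subr_le0 leNgt; apply/negP => ex.
by apply: Vx; apply: hV; exact: ltW.
Qed.

Lemma le_state_trunc e h : continuous h -> I h <= I (trunc e h) + e.
Proof.
move=> ch; have cc := @cts_const R K e.
rewrite -[X in _ + X](state_cst stI) -(stateD stI)//; last exact: cts_trunc.
apply: (le_state stI) => // [|x]; first by apply: ctsD => //; exact: cts_trunc.
by rewrite -lerBlDr /trunc le_max lexx.
Qed.

(** A function [h] below the union, truncated at [e], is supported in the closed
    set [C] where [h] is at least [e]. A Urysohn function equal to [1] on the part
    of [C] outside [V] and to [0] outside [U] splits it into a summand below [U]
    and a summand below [V]. *)
Lemma inner_contentU U V : open U -> open V ->
  (inner_content (U `|` V) <= inner_content U + inner_content V)%E.
Proof.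
move=> oU oV; apply: ge_ereal_sup => _ [h bh <-].
apply/lee_addgt0Pr => e e0.
pose C := [set x | e <= h x].
have clC : closed C by exact: closed_ge_cts bh.1.
have CUV x : C x -> U x \/ V x.
  move=> Cx; have [//|nUV] := pselect ((U `|` V) x).
  by move: Cx; rewrite /C/= (below_out bh nUV) leNgt e0.
have [u [cu u01 u1 u0]] : exists u : K -> R, [/\ continuous u,
    forall x, 0 <= u x <= 1, forall x, (C `\` V) x -> u x = 1 &
    forall x, ~ U x -> u x = 0].
  apply: urysohn_compact => //.
    by apply: closedI => //; exact: open_closedC.
  by move=> x [/CUV[]].
have bt : below C (trunc e h) by exact: (below_trunc bh).
have tr01 := below_le1 bt; have ct := bt.1.
have bU : below U (fun x => trunc e h x * u x).
  apply: belowP => [|x|x /u0->]; [exact: ctsM| |by rewrite mulr0].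
  by case/andP: (tr01 x) => ? ?; case/andP: (u01 x) => ? ?;
    rewrite mulr_ge0// mulr_ile1.
have bV : below V (fun x => trunc e h x * (1 - u x)).
  have c1u : continuous (fun x => 1 - u x).
    by apply: ctsB => //; exact: cts_const.
  apply: belowP => [|x|x Vx]; first exact: ctsM.
    case/andP: (tr01 x) => ? ?; case/andP: (u01 x) => ? ?.
    by rewrite mulr_ge0 ?subr_ge0// mulr_ile1 ?subr_ge0// gerBl.
  have [Cx|Cx] := pselect (C x); first by rewrite u1// subrr mulr0.
  by rewrite (below_out bt Cx) mul0r.
have bUV := leeD (inner_content_ub bU) (inner_content_ub bV).
apply: le_trans (leeD bUV (lexx _)).
rewrite -!EFinD lee_fin -(stateD stI); [|exact: bU.1|exact: bV.1].
rewrite (_ : (fun x => _) = trunc e h); first exact: le_state_trunc bh.1.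
by apply/funext => x; rewrite -mulrDr addrC subrK mulr1.
Qed.

Lemma inner_content_bigsetU (U : nat -> set K) n : (forall i, open (U i)) ->
  (inner_content (\big[setU/set0]_(i < n) U i) <=
   \sum_(i < n) inner_content (U i))%E.
Proof.
move=> oU; elim: n => [|n IH].
  rewrite !big_ord0; apply: ge_ereal_sup => _ [h bh <-].
  rewrite (_ : h = fun=> 0) ?(state_cst stI)//.
  by apply/funext => x; apply: (below_out bh).
rewrite !big_ord_recr/=; apply: le_trans (leeD IH (lexx _)).
by apply: inner_contentU => //; rewrite -bigcup_mkord; apply: bigcup_open.
Qed.

(** By compactness, the set where [h] is at least [e] is covered by
    finitely many of the open sets. *)
Lemma inner_content_bigcup (U : nat -> set K) : (forall i, open (U i)) ->
  (inner_content (\bigcup_i U i) <= \sum_(i <oo) inner_content (U i))%E.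
Proof.
move=> oU; apply: ge_ereal_sup => _ [h bh <-].
apply/lee_addgt0Pr => e e0.
have cC : compact [set x | e <= h x].
  by apply/compact_closedE => //; exact: closed_ge_cts bh.1.
have [n CU] : exists n, [set x | e <= h x] `<=` \big[setU/set0]_(i < n) U i.
  move: cC; rewrite compact_cover => /(_ nat [set: nat] U)[|x /= ex|D _ CD].
  - by move=> i _; exact: oU.
  - have [//|nU] := pselect ((\bigcup_i U i) x).
    by move: ex; rewrite (below_out bh nU) leNgt e0.
  - exists (\max_(i <- finmap.enum_fset D) i).+1 => x /CD[i iD Ux].
    rewrite -bigcup_mkord; exists i => //=; rewrite ltnS.
    by apply: leq_bigmax_seq.
have bt := below_trunc bh e0 CU.
apply: (@le_trans _ _ (I (trunc e h) + e)%:E).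
  by rewrite lee_fin; exact: le_state_trunc bh.1.
rewrite EFinD leeD2r//; apply: (le_trans (inner_content_ub bt)).
apply: (le_trans (inner_content_bigsetU _ oU)).
rewrite -(big_mkord xpredT (fun i => inner_content (U i))).
by apply: nneseries_lim_ge => i _ _; exact: inner_content_ge0.
Qed.

Lemma riesz_outer_open U : open U -> riesz_outer U = inner_content U.
Proof.
move=> oU; apply/eqP; rewrite eq_le; apply/andP; split.
  by apply: ereal_inf_lbound; exists U => //; split.
by apply: le_ereal_inf_tmp => _ [V [oV UV] <-]; exact: le_inner_content.
Qed.

Lemma riesz_outer_adherent (A : set K) (e : R) : 0 < e ->
  exists2 U, open U /\ A `<=` U & (inner_content U <= riesz_outer A + e%:E)%E.
Proof.
move=> e0; have fA : riesz_outer A \is a fin_num.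
  rewrite fin_real//; apply/andP; split.
    apply: lt_le_trans (ltNyr 0) _; apply: le_ereal_inf_tmp => _ [U _ <-].
    exact: inner_content_ge0.
  apply: le_lt_trans (ltry 1); apply: (@le_trans _ _ (inner_content setT)).
    by apply: ereal_inf_lbound; exists setT => //; split=> //; exact: openT.
  exact: inner_content_le1.
have [_ [U oU <-] lU] := lb_ereal_inf_adherent e0 fA.
by exists U => //; exact: ltW.
Qed.

Let riesz_outer0 : riesz_outer set0 = 0%E.
Proof.
rewrite riesz_outer_open; last exact: open0.
apply/eqP; rewrite eq_le inner_content_ge0 andbT.
apply: ge_ereal_sup => _ [h bh <-]; rewrite (_ : h = fun=> 0) ?(state_cst stI)//.
by apply/funext => x; apply: (below_out bh).
Qed.

Let riesz_outer_ge0 A : (0 <= riesz_outer A)%E.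
Proof. by apply: le_ereal_inf_tmp => _ [U _ <-]; exact: inner_content_ge0. Qed.

Let le_riesz_outer : {homo riesz_outer : A B / A `<=` B >-> (A <= B)%E}.
Proof.
move=> A B AB; apply: le_ereal_inf_tmp => _ [U [oU BU] <-].
by apply: ereal_inf_lbound; exists U => //; split=> // x /AB/BU.
Qed.

Let riesz_outer_sigma_subadditive : sigma_subadditive riesz_outer.
Proof.
move=> A; apply/lee_addgt0Pr => e e0.
have e2 n : 0 < e / (2 ^ n.+1)%:R by rewrite divr_gt0// ltr0n expn_gt0.
have /choice[U HU] n : exists U, (open U /\ A n `<=` U) /\
    (inner_content U <= riesz_outer (A n) + (e / (2 ^ n.+1)%:R)%:E)%E.
  by have [U ? ?] := riesz_outer_adherent (A n) (e2 n); exists U.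
apply: (@le_trans _ _ (inner_content (\bigcup_i U i))).
  apply: ereal_inf_lbound; exists (\bigcup_i U i) => //; split.
    by apply: bigcup_open => i _; exact: (HU i).1.1.
  by move=> x [i _ Ax]; exists i => //; exact: (HU i).1.2.
apply: (le_trans (inner_content_bigcup (fun i => (HU i).1.1))).
apply: (@le_trans _ _
  (\sum_(i <oo) (riesz_outer (A i) + (e / (2 ^ i.+1)%:R)%:E))%E).
  apply: lee_nneseries => [n _ _|n _]; first exact: inner_content_ge0.
  exact: (HU n).2.
by apply: epsilon_trick => [n|]; [exact: riesz_outer_ge0|exact: ltW].
Qed.

HB.instance Definition _ := isOuterMeasure.Build R K riesz_outer
  riesz_outer0 riesz_outer_ge0 le_riesz_outer riesz_outer_sigma_subadditive.

(** Inside an open [V], choose [h] nearly optimal below the intersection with [U]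
    and then [g] nearly optimal below the complement in [V] of the closed set
    where [h] is at least [e / 3]. Truncating [h] makes the supports disjoint, so
    that the sum stays below [V]. *)
Lemma open_caratheodory U : open U -> riesz_outer.-caratheodory U.
Proof.
move=> oU; apply: le_caratheodory_measurable => X.
apply: le_ereal_inf_tmp => _ [V [oV XV] <-].
apply: (@le_trans _ _ (riesz_outer (V `&` U) + riesz_outer (V `&` ~` U))%E).
  by apply: leeD; apply: le_outer_measure; exact: setSI.
apply/lee_addgt0Pr => e e0.
have e3 : 0 < e / 3 by rewrite divr_gt0.
rewrite riesz_outer_open; last exact: openI.
have [h bh lh] := inner_content_adherent (V `&` U) e3.
pose C := [set x | e / 3 <= h x].
have oVC : open (V `&` ~` C).
  by apply: openI => //; apply: closed_openC; exact: closed_ge_cts bh.1.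
have [g bg lg] := inner_content_adherent (V `&` ~` C) e3.
have VUC : V `&` ~` U `<=` V `&` ~` C.
  move=> x [Vx Ux]; split=> //=; rewrite /C/= (below_out bh) => [|[]//].
  by rewrite leNgt e3.
have bt : below C (trunc (e / 3) h) by exact: (below_trunc bh).
have bV : below V (fun x => trunc (e / 3) h x + g x).
  apply: belowP; first by apply: ctsD; [exact: bt.1|exact: bg.1].
    move=> x; have [Cx|Cx] := pselect (C x).
      by rewrite (below_out bg) ?addr0; [exact: (below_le1 bt x)|case].
    by rewrite (below_out bt) ?add0r//; exact: (below_le1 bg x).
  move=> x Vx; rewrite (below_out bg) ?addr0; last by case.
  rewrite /trunc (below_out bh); last by case.
  by rewrite max_r// sub0r oppr_le0 ltW.
apply: le_trans (leeD (inner_content_ub bV) (lexx e%:E)).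
apply: (@le_trans _ _ ((I h + e / 3)%:E + (I g + e / 3)%:E)%E).
  apply: leeD => //; apply: le_trans lg; rewrite -riesz_outer_open//.
  exact: le_outer_measure.
rewrite -!EFinD lee_fin (stateD stI); [|exact: bt.1|exact: bg.1].
by have := le_state_trunc (e / 3) bh.1; lra.
Qed.

Lemma borel_caratheodory (A : set (borel K)) :
  measurable A -> riesz_outer.-caratheodory A.
Proof.
move=> mA.
have sub : <<s @open K >> `<=` (riesz_outer.-caratheodory : set (set K)).
  apply: smallest_sub; last exact: open_caratheodory.
  exact: (@sigma_algebra_measurable _ (caratheodory_type riesz_outer)).
exact: (sub A mA).
Qed.

Definition riesz_measure : set (borel K) -> \bar R := riesz_outer.

Let riesz_measure_semi_sigma_additive : semi_sigma_additive riesz_measure.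
Proof.
move=> F mF tF mUF.
apply: (@caratheodory_measure_sigma_additive R K riesz_outer F) => //.
  by move=> i; exact: borel_caratheodory (mF i).
exact: borel_caratheodory mUF.
Qed.

HB.instance Definition _ := isMeasure.Build _ (borel K) R riesz_measure
  riesz_outer0 riesz_outer_ge0 riesz_measure_semi_sigma_additive.

Let riesz_measureT : riesz_measure [set: borel K] = 1%E.
Proof.
rewrite /riesz_measure riesz_outer_open; last exact: openT.
exact: inner_content_setT.
Qed.

HB.instance Definition _ :=
  Measure_isProbability.Build _ _ _ riesz_measure riesz_measureT.

Lemma riesz_measure_regular : regular_borel riesz_measure.
Proof.
apply: regular_borelP => // A mA e e0.
have [U [oU AU] lU] := riesz_outer_adherent (~` A) e0.
exists (~` U); first by split; [exact: open_closedC|exact: subsetCl].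
have mU := measurable_open oU.
have eU : (riesz_measure (~` U) = 1 - riesz_measure U)%E.
  exact: probability_setC.
have eA : (riesz_measure (~` A) = 1 - riesz_measure A)%E.
  exact: probability_setC.
have {}lU : (riesz_measure U <= riesz_measure (~` A) + e%:E)%E.
  by rewrite [leLHS]riesz_outer_open.
suff : (riesz_measure A <= riesz_measure (~` U) + e%:E)%E by [].
move: lU; rewrite eU eA.
have /fineK <- : riesz_measure U \is a fin_num by exact: fin_num_measure.
have /fineK <- : riesz_measure A \is a fin_num by exact: fin_num_measure.
by rewrite -!EFinB -!EFinD !lee_fin; lra.
Qed.

Let m : probability (borel K) R := riesz_measure.

Let state_m := integral_state m cK.

Lemma le_riesz_measure U h g : open U -> below U h -> continuous g ->
  (forall x, \1_U x <= g x) -> I h <= \int[m]_x g x.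
Proof.
move=> oU bh cg Ug; rewrite -lee_fin.
apply: (@le_trans _ _ (riesz_measure U)).
  by rewrite [leRHS]riesz_outer_open//; exact: inner_content_ub.
by apply: le_measure_integral => //; exact: measurable_open.
Qed.

(** The part of the graph of [h] between the levels [k / n.+1] and [k.+1 / n.+1];
    scaled by [n.+1], it lies between the indicators of the sets where [h] exceeds
    the upper and the lower level. *)
Definition slice (n k : nat) h : K -> R :=
  fun x => Num.min (trunc (k%:R / n.+1%:R) h x) n.+1%:R^-1.

Lemma cts_slice n k h : continuous h -> continuous (slice n k h).
Proof.
by move=> ch; apply: cts_min; [exact: cts_trunc|exact: cts_const].
Qed.

Lemma slice_ge0 n k h x : 0 <= slice n k h x.
Proof. by rewrite /slice/trunc le_min le_max lexx orbT invr_ge0/=. Qed.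

Lemma slice_sum n j h x : 0 <= h x ->
  \sum_(k < j) slice n k h x = Num.min (h x) (j%:R / n.+1%:R).
Proof.
move=> h0; elim: j => [|j IH]; first by rewrite big_ord0 mul0r min_r.
rewrite big_ord_recr/= IH -[in RHS]natr1 mulrDl mul1r /slice /trunc.
have : 0 <= j%:R / n.+1%:R :> R by rewrite divr_ge0.
have : 0 < n.+1%:R^-1 :> R by rewrite invr_gt0.
move: (n.+1%:R^-1) (j%:R / _) => b a b0 a0.
by rewrite /Num.max; case: ltP => ?; rewrite /Num.min; do 3?case: ltP => ?; lra.
Qed.

(** The slices of [h] for [I] are compared with those of the integral one level
    below, across the open set on which [h] exceeds the common level. *)
Lemma slice_le n k h : continuous h ->
  I (slice n k.+1 h) <= \int[m]_x slice n k h x.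
Proof.
move=> ch; have n0 : 0 < n.+1%:R :> R by [].
have cs j : continuous (fun x => n.+1%:R * slice n j h x).
  by apply: ctsZ; exact: cts_slice.
rewrite -(ler_pM2l n0) -(stateZ stI); last exact: cts_slice.
rewrite -(stateZ state_m); last exact: cts_slice.
apply: (@le_riesz_measure [set x | k.+1%:R / n.+1%:R < h x]) => //.
- exact: open_gt_cts.
- apply: belowP => // [x|x /negP].
    by rewrite mulr_ge0 ?slice_ge0//= -ler_pdivlMl// mulr1 ge_min lexx orbT.
  rewrite -leNgt /slice /trunc => hk; rewrite max_r ?subr_le0//.
  by rewrite min_l ?mulr0// invr_ge0.
- move=> x; rewrite indicE; case: (boolP (x \in _)) => [/set_mem/= hx|_].
    rewrite /slice min_r ?mulfV// /trunc le_max lerBrDl.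
    by rewrite -[in X in _ + X](mul1r _^-1) -mulrDl natr1 (ltW hx).
  by rewrite mulr_ge0 ?slice_ge0.
Qed.

(** Summing the slices, the shift by one level costs the bottom slice of [h] only,
    at most [n.+1^-1]. *)
Lemma state_le_riesz h : continuous h -> (forall x, 0 <= h x <= 1) ->
  I h <= \int[m]_x h x.
Proof.
move=> ch h01; have h0 x : 0 <= h x by case/andP: (h01 x).
suff le_n n : I h <= \int[m]_x h x + n.+1%:R^-1.
  apply/ler_addgt0Pr => e e0.
  have [n _ ne] := near_infty_natSinv_lt (PosNum e0).
  by apply: (le_trans (le_n n)); rewrite lerD2l ltW//; exact: (ne n (leqnn n)).
have -> : I h = \sum_(k < n.+1) I (slice n k h).
  rewrite -(state_sum stI _ (fun k => @cts_slice n k h ch)).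
  congr I; apply/funext => x; rewrite slice_sum// mulfV// min_l//.
  by case/andP: (h01 x).
rewrite big_ord_recl addrC lerD//.
  apply: (@le_trans _ _ (\sum_(k < n) \int[m]_x slice n k h x)).
    by apply: ler_sum => k _; exact: slice_le.
  rewrite -(state_sum state_m _ (fun k => @cts_slice n k h ch)).
  rewrite (_ : (fun x => _) = fun x => Num.min (h x) (n%:R / n.+1%:R)).
    apply: (le_state state_m) => // [|x]; last by rewrite ge_min lexx.
    by apply: cts_min => //; exact: cts_const.
  by apply/funext => x; rewrite slice_sum.
rewrite -[leRHS](state_cst stI).
apply: (le_state stI); [exact: cts_slice|exact: cts_const|].
by move=> x; rewrite /slice ge_min lexx orbT.
Qed.

Lemma riesz_measureE h : continuous h -> \int[m]_x h x = I h.
Proof.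
have eq01 g : continuous g -> (forall x, 0 <= g x <= 1) -> \int[m]_x g x = I g.
  (* The inequality for [1 - g] is the reverse inequality for [g]. *)
  move=> cg g01; apply/eqP; rewrite eq_le state_le_riesz// andbT.
  have c1 := @cts_const R K 1.
  have := @state_le_riesz (fun x => 1 - g x) (ctsB c1 cg) _.
  rewrite (stateB stI)// (stateB state_m)// (state_cst stI) (state_cst state_m).
  rewrite lerD2l lerN2; apply => x; have /andP[g0 g1] := g01 x.
  by rewrite subr_ge0 g1 gerBl.
move=> ch; have [M M0 hM] := cts_bounded cK ch.
have M2 : 0 < 2 * M by rewrite mulr_gt0.
pose g x := (2 * M)^-1 * (h x + M).
have chM : continuous (fun x => h x + M) by apply: ctsD => //; exact: cts_const.
have cg : continuous g by exact: ctsZ.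
have g01 x : 0 <= g x <= 1.
  have := hM x; rewrite ler_norml => /andP[h1 h2].
  rewrite /g mulr_ge0 ?invr_ge0 ?(ltW M2) -?ler_subl_addr ?sub0r ?lerBlDr//=.
    by rewrite ler_pdivrMl// mulr1 mulr_natl mulr2n lerD2r.
  by rewrite -lerBlDr sub0r.
have -> : h = fun x => 2 * M * g x + - M.
  by apply/funext => x; rewrite /g mulrA mulfV ?gt_eqF// mul1r addrK.
have c2 : continuous (fun x => 2 * M * g x) by exact: ctsZ.
have cM := @cts_const R K (- M).
rewrite (stateD stI)// (stateD state_m)// (stateZ stI)// (stateZ state_m)//.
by rewrite (state_cst stI) (state_cst state_m) eq01.
Qed.

End riesz.

Theorem riesz_representation (R : realType) (K : ptopologicalType)
    (I : (K -> R) -> R) :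
  compact [set: K] -> hausdorff_space K -> state I ->
  exists mu : Prob R K, forall f : K -> R, continuous f -> \int[mu]_x f x = I f.
Proof.
move=> cK hK stI.
have [mu muE] := Prob_exists hK (riesz_measure_regular cK hK stI).
exists mu => f cf; rewrite -(riesz_measureE cK hK stI cf).
congr fine; apply: eq_measure_integral => A mA _; exact: muE.
Qed.

(** * Image measures and the weak* topology *)

Section image_measure.
Context (R : realType) (K L : ptopologicalType) (q : K -> L).
Hypotheses (cK : compact [set: K]) (hK : hausdorff_space K).
Hypotheses (cL : compact [set: L]) (hL : hausdorff_space L).
Hypothesis cq : continuous q.

Let qmixin := isMeasurableFun.Build _ _ _ _ _ (cts_measurable_borel cq).
Let qm : {mfun borel K >-> borel L} :=
  MeasurableFun.Pack (MeasurableFun.Class qmixin).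

Lemma integral_image (mu : probability (borel K) R)
    (nu : probability (borel L) R) :
  pushforward mu (q : borel K -> borel L) ≡B nu ->
  forall f : L -> R, continuous f -> \int[nu]_x f x = \int[mu]_x f (q x).
Proof.
move=> e f cf; transitivity (\int[distribution mu qm]_x f x).
  by congr fine; apply: eq_measure_integral => A mA _; exact: (esym (e A mA)).
congr fine; rewrite integral_distribution//.
  by apply/measurable_EFinP; exact: cts_measurable.
have cfq : continuous (f \o q) by exact: cts_comp cq cf.
exact: (cts_integrable mu cK cfq).
Qed.

(** Images of compact sets are compact, so inner regularity is inherited. *)
Lemma image_regular (mu : probability (borel K) R) :
  regular_borel mu -> regular_borel (distribution mu qm).
Proof.
move=> rmu; apply: regular_borelP => // A mA e e0.
have mqA : measurable (q @^-1` A : set (borel K)).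
  by rewrite -[X in measurable X]setTI; exact: (cts_measurable_borel cq).
have [C [clC CA] lC] := regular_inner cK hK rmu mqA e0.
have clqC : closed (q @` C).
  apply: compact_closed => //; apply: continuous_compact.
    exact: continuous_subspaceT.
  exact/compact_closedE.
exists (q @` C); first by split=> // _ [x /CA Ax <-].
apply: (le_trans lC); rewrite leeD2r//; apply: le_measure; rewrite ?inE.
- exact: measurable_closed.
- rewrite -[X in measurable X]setTI; apply: (cts_measurable_borel cq) => //.
  exact: measurable_closed.
- by move=> x Cx; exists x.
Qed.

Lemma image_eqP (mu : probability (borel K) R) (nu : probability (borel L) R) :
  regular_borel mu -> regular_borel nu ->
  (forall f : L -> R, continuous f -> \int[nu]_x f x = \int[mu]_x f (q x)) ->
  pushforward mu (q : borel K -> borel L) ≡B nu.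
Proof.
move=> rmu rnu e.
apply: (@regular_uniq R L cL hL (distribution mu qm) nu) => // [|f cf].
  exact: image_regular.
by rewrite e//; exact: integral_image.
Qed.

End image_measure.

Section dirac.
Context (R : realType) (L : ptopologicalType).
Hypotheses (cL : compact [set: L]) (hL : hausdorff_space L).

Lemma dirac_regular (l : L) :
  regular_borel (\d_(l : borel L) : set (borel L) -> \bar R).
Proof.
apply: regular_borelP => // A mA e e0.
have [Al|Al] := pselect (A l).
  exists [set l].
    split=> [|_ ->//].
    exact: (accessible_closed_set1 (hausdorff_accessible hL)).
  rewrite [leLHS]diracE [X in (_ <= X + _)%E]diracE !mem_set//.
  by rewrite leeDl// lee_fin ltW.
exists set0; first by split; [exact: closed0|].
by rewrite [leLHS]diracE memNset//; apply: adde_ge0 => //; rewrite lee_fin ltW.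
Qed.

Lemma Rintegral_dirac (l : L) (f : L -> R) : continuous f ->
  \int[\d_(l : borel L)]_x f x = f l.
Proof.
move=> cf; rewrite /Rintegral integral_dirac//; first by rewrite diracT mul1e.
by apply/measurable_EFinP; exact: cts_measurable.
Qed.

End dirac.

Section weak_star.
Context (R : realType) (K L : ptopologicalType) (nu : L -> Prob R K).

Lemma weak_star_cvg : continuous nu <->
  forall f : K -> R, continuous f -> continuous (fun l => \int[nu l]_x f x).
Proof.
split=> [cnu f cf|cnu].
  have ce : continuous (@Prob_eval R K \o nu).
    move=> l; apply: continuous_comp; first exact: cnu.
    exact: initial_continuous.
  move=> l; have := ce l.
  pose F : continuousType K R := mkcts cf.
  move=> h; have := cvg_comp _ _ h
    (@proj_continuous (continuousType K R) (fun=> R) F (Prob_eval (nu l))).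
  exact.
apply: continuous_comp_initial => l.
apply/cvg_sup => f; apply/cvg_image.
  by apply/seteqP; split=> // v _; exists (fun=> v).
move=> W /(cnu f (@cts_fun _ _ f) l) Wl /=.
exists ((fun h : {ptws continuousType K R -> R} => h f) @^-1` W) => //.
by apply/seteqP; split=> [_ [h ? <-]//|w Ww]; exists (fun=> w).
Qed.

End weak_star.

(** * Continuous functions under a measure of full support *)

Section full_support.
Context (R : realType) (L : ptopologicalType) (muL : Prob R L).
Hypotheses (cL : compact [set: L]) (fs : fully_supported muL).

Let st := integral_state muL cL.

Lemma full_support_eq0 (g : L -> R) : continuous g -> (forall l, 0 <= g l) ->
  \int[muL]_l g l = 0 -> forall l, g l = 0.
Proof.
move=> cg g0 ig l; apply/eqP; rewrite eq_le g0 andbT leNgt; apply/negP => gl.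
pose U := [set x | g l / 2 < g x].
have oU : open U by exact: open_gt_cts.
have : msupport muL l by rewrite fs.
move=> /(_ U oU); rewrite /U /= ltr_pdivrMr// mulr_natr mulr2n ltrDl => /(_ gl).
apply/negP; rewrite -leNgt.
have c2 : continuous (fun x => (g l / 2)^-1 * g x) by exact: ctsZ.
have gl2 : 0 < g l / 2 by rewrite divr_gt0.
have <- : (\int[muL]_x ((g l / 2)^-1 * g x))%:E = 0%E :> \bar R.
  by rewrite (stateZ st)// ig mulr0.
apply: le_measure_integral => //; first exact: measurable_open.
move=> x; rewrite indicE; case: (boolP (x \in _)) => [/set_mem/= Ux|_].
  by rewrite ler_pdivlMl// mulr1 ltW.
by rewrite mulr_ge0// invr_ge0 ltW.
Qed.

(** Tested against the negative part $n$ of [F], the hypothesis gives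
    $-\int n^2 \geq 0$, hence $n = 0$. *)
Lemma full_support_ge0 (F : L -> R) : continuous F ->
  (forall g : L -> R, continuous g -> (forall l, 0 <= g l) ->
    0 <= \int[muL]_l (F l * g l)) ->
  forall l, 0 <= F l.
Proof.
move=> cF Fg l; pose n x := Num.max (- F x) 0.
have cn : continuous n.
  apply: cts_max; last exact: cts_const.
  by move=> x; apply: continuousN; exact: cF.
have n0 x : 0 <= n x by rewrite /n le_max lexx orbT.
have nn x : F x * n x = - 1 * (n x * n x).
  by rewrite /n /Num.max; case: ltP; lra.
have cnn : continuous (fun x => n x * n x) by exact: ctsM.
have : 0 <= \int[muL]_x (F x * n x) by exact: Fg.
rewrite (_ : (fun x => F x * n x) = fun x => -1 * (n x * n x));
  last exact/funext.
rewrite (stateZ st)// mulN1r oppr_ge0 => nn0.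
have : n l * n l = 0.
  apply: (@full_support_eq0 (fun x => n x * n x)) => // [x|].
    by rewrite mulr_ge0.
  apply/le_anti; rewrite nn0/=; apply: (state_ge0 st) => // x.
  by rewrite mulr_ge0.
move=> /eqP; rewrite mulf_eq0 orbb => /eqP nl.
by have := le_max (- F l) (- F l) 0; rewrite -/(n l) nl lexx/= oppr_le0.
Qed.

Lemma full_support_uniq (F1 F2 : L -> R) : continuous F1 -> continuous F2 ->
  (forall g : L -> R, continuous g ->
    \int[muL]_l (F1 l * g l) = \int[muL]_l (F2 l * g l)) ->
  F1 = F2.
Proof.
move=> c1 c2 e; apply/funext => l; apply/le_anti.
suff H (A B : L -> R) : continuous A -> continuous B ->
    (forall g : L -> R, continuous g ->
      \int[muL]_l (A l * g l) = \int[muL]_l (B l * g l)) -> A l <= B l.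
  by rewrite !H// => g cg; rewrite e.
move=> cA cB AB; rewrite -subr_ge0.
apply: (@full_support_ge0 (fun x => B x - A x)) => [|g cg _]; first exact: ctsB.
rewrite (_ : (fun x => _) = fun x => B x * g x - A x * g x).
  by rewrite (stateB st) ?AB ?subrr//; exact: ctsM.
by apply/funext => x; rewrite mulrBl.
Qed.

End full_support.

(** * Integrating a relatively invariant measure *)

Section fibre.
Context (R : realType) (K L : ptopologicalType) (q : K -> L).
Hypotheses (cK : compact [set: K]) (cL : compact [set: L]) (cq : continuous q).

(** On the fibre over [l] the function $g \circ q$ is the constant $g(l)$. The
    image measure sees this as $\int |g \circ q - g(l)| d\mu = 0$. *)
Lemma fibre_integral (mu : probability (borel K) R) (l : L) :
  pushforward mu (q : borel K -> borel L) ≡B \d_(l : borel L) ->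
  forall (f : K -> R) (g : L -> R), continuous f -> continuous g ->
  \int[mu]_x (f x * g (q x)) = g l * \int[mu]_x f x.
Proof.
move=> e f g cf cg; have st := integral_state mu cK.
have [M M0 fM] := cts_bounded cK cf.
have cgl := @cts_const R L (g l).
have cd : continuous (fun x => g x - g l) by exact: ctsB.
have ca : continuous (fun x => `|g x - g l|).
  by move=> x; apply: (continuous_comp (cd x)); exact: norm_continuous.
have a0 : \int[mu]_x `|g (q x) - g l| = 0.
  by rewrite -(integral_image cK cq e ca) Rintegral_dirac// subrr normr0.
have cgq : continuous (g \o q) by exact: cts_comp cq cg.
have caq : continuous (fun x => `|g (q x) - g l|) by exact: cts_comp cq ca.
have cp : continuous (fun x => f x * g (q x)) by exact: ctsM.
have cr : continuous (fun x => g l * f x) by exact: ctsZ.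
have cMa : continuous (fun x => M * `|g (q x) - g l|) by exact: ctsZ.
have bound x : `|f x * g (q x) - g l * f x| <= M * `|g (q x) - g l|.
  by rewrite [g l * _]mulrC -mulrBr normrM ler_wpM2r.
rewrite -(stateZ st)//; apply/eqP; rewrite eq_le; apply/andP; split.
  rewrite -subr_le0 -(stateB st)// -[leRHS](mulr0 M) -a0 -(stateZ st)//.
  apply: (le_state st) => // [|x]; first exact: ctsB.
  exact: le_trans (ler_norm _) (bound x).
rewrite -subr_le0 -(stateB st)// -[leRHS](mulr0 M) -a0 -(stateZ st)//.
apply: (le_state st) => // [|x]; first exact: ctsB.
by apply: le_trans (ler_norm _) _; rewrite distrC.
Qed.

End fibre.

Section integral_of_RIM.
Context (R : realType) (G : groupType) (K L : ptopologicalType).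
Context (phi : G -> K -> K) (psi : G -> L -> L) (q : K -> L) (muL : Prob R L).
Hypothesis ext : is_extension phi psi q.

Lemma ext_cK : compact [set: K]. Proof. by case: ext => -[]. Qed.
Lemma ext_hK : hausdorff_space K. Proof. by case: ext => -[]. Qed.
Lemma ext_cL : compact [set: L]. Proof. by case: ext => _ []. Qed.
Lemma ext_hL : hausdorff_space L. Proof. by case: ext => _ []. Qed.
Lemma ext_q : continuous q. Proof. by case: ext. Qed.
Lemma ext_phi t : continuous (phi t).
Proof. by case: ext => -[_ _ /(_ t)[]]. Qed.
Lemma ext_psi t : homeomorphism (psi t).
Proof. by case: ext => _ [_ _ /(_ t)]. Qed.
Lemma ext_qphi t x : q (phi t x) = psi t (q x).
Proof. by case: ext => _ _ _ _ /(_ t)/(congr1 (@^~ x)). Qed.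

Let cK := ext_cK.
Let hK := ext_hK.
Let cL := ext_cL.
Let hL := ext_hL.
Let cq := ext_q.
Let cphi := ext_phi.

Section one_RIM.
Variable nu : L -> Prob R K.
Hypothesis rim : RIM R phi psi q nu.

Lemma RIM_cts (f : K -> R) :
  continuous f -> continuous (fun l => \int[nu l]_x f x).
Proof. by case: rim => _ cnu _ _; move: f; exact/weak_star_cvg. Qed.

Lemma RIM_fibre l (f : K -> R) (g : L -> R) : continuous f -> continuous g ->
  \int[nu l]_x (f x * g (q x)) = g l * \int[nu l]_x f x.
Proof. by case: rim => _ _ /(_ l) e _; exact: fibre_integral. Qed.

Lemma RIM_equivariant t l (f : K -> R) : continuous f ->
  \int[nu (psi t l)]_x f x = \int[nu l]_x f (phi t x).
Proof.
by case: rim => _ _ _ /(_ t l) e; apply: integral_image => //; exact: cphi.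
Qed.

Lemma RIM_integral_state :
  state (fun f : K -> R => \int[muL]_l \int[nu l]_x f x).
Proof.
have st := integral_state muL cL.
have stn l := integral_state (nu l) cK.
split=> [f g cf cg|a f cf|f cf f0|].
- rewrite -(stateD st); [|exact: RIM_cts|exact: RIM_cts].
  by apply: eq_Rintegral => l _; rewrite (stateD (stn l)).
- rewrite -(stateZ st); last exact: RIM_cts.
  by apply: eq_Rintegral => l _; rewrite (stateZ (stn l)).
- apply: (state_ge0 st); first exact: RIM_cts.
  by move=> l; apply: (state_ge0 (stn l)).
- rewrite -[RHS](state_cst st).
  by apply: eq_Rintegral => l _; exact: (state_cst (stn l)).
Qed.

Lemma RIM_integral_exists : invariant_measures psi muL ->
  exists2 muK : Prob R K, invariant_lifts phi q muL muK &
    forall f : K -> R, continuous f ->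
      \int[muK]_x f x = \int[muL]_l \int[nu l]_x f x.
Proof.
move=> inv; have [muK muKE] := riesz_representation cK hK RIM_integral_state.
exists muK => //; split.
  move=> t; have ct : continuous (phi t) by exact: cphi.
  apply: image_eqP => //; [exact: Prob_regular..|] => f cf.
  have cft : continuous (fun x => f (phi t x)) by exact: cts_comp cf.
  rewrite !muKE//; have [cpsi _] := ext_psi t.
  rewrite (integral_image cL cpsi (inv t)); last exact: RIM_cts.
  by apply: eq_Rintegral => l _; rewrite RIM_equivariant.
apply: image_eqP => //; [exact: Prob_regular..|] => g cg.
rewrite muKE; last exact: cts_comp cg.
apply: eq_Rintegral => l _.
have c1 := @cts_const R K 1.
have := RIM_fibre l c1 cg; under eq_Rintegral do rewrite mul1r.
by rewrite (state_cst (integral_state (nu l) cK)) mulr1 => ->.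
Qed.

End one_RIM.

(** Testing against $f (g \circ q)$ turns equality of the integrals into equality
    of $\int g(l) \nu_l(f) d\mu_L$ for all [g]. *)
Lemma RIM_integral_inj (nu1 nu2 : L -> Prob R K) : fully_supported muL ->
  RIM R phi psi q nu1 -> RIM R phi psi q nu2 ->
  (forall f : K -> R, continuous f ->
    \int[muL]_l \int[nu1 l]_x f x = \int[muL]_l \int[nu2 l]_x f x) ->
  nu1 = nu2.
Proof.
move=> fs r1 r2 e; apply/funext => l; apply/Prob_eq.
apply: regular_uniq => //; [exact: Prob_regular..|] => f cf.
have := full_support_uniq cL fs (RIM_cts r1 cf) (RIM_cts r2 cf).
move=> /(_ _)/(congr1 (@^~ l)); apply.
move=> g cg; have cfg : continuous (fun x => f x * g (q x)).
  by apply: ctsM => //; exact: cts_comp cg.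
have := e _ cfg.
under eq_Rintegral do rewrite (RIM_fibre r1)// mulrC.
by under [in RHS]eq_Rintegral do rewrite (RIM_fibre r2)// mulrC.
Qed.

End integral_of_RIM.

(** * Bounded densities and their continuous representatives *)

Section density.
Context (R : realType) (L : ptopologicalType).
Context (rho mu : probability (borel L) R) (M : R).
Hypotheses (cL : compact [set: L]) (M0 : 0 < M).
Hypothesis rho_le : forall A, measurable A -> (rho A <= M%:E * mu A)%E.

Let rho_mu : rho `<< mu.
Proof.
apply/null_content_dominatesP => A mA A0; apply/eqP.
by rewrite eq_le measure_ge0 andbT (le_trans (rho_le mA))// A0 mule0.
Qed.

(** The Radon-Nikodym density is at most [M] almost everywhere; the set where it
    exceeds [2 * M] is already seen to be null by comparing measures, so it can be
    truncated there. *)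
Lemma bounded_density : exists h : borel L -> R,
  [/\ measurable_fun [set: borel L] h, forall x, `|h x| <= 2 * M &
    forall g : L -> R, continuous g ->
      \int[mu]_x (h x * g x) = \int[rho]_x g x].
Proof.
pose d := Radon_Nikodym_SigmaFinite.f rho mu.
have d0 := Radon_Nikodym_SigmaFinite.f_ge0 rho_mu.
have dfin := Radon_Nikodym_SigmaFinite.f_fin_num rho_mu.
have dint := Radon_Nikodym_SigmaFinite.f_integrable rho_mu.
have md : measurable_fun [set: borel L] d by exact: measurable_int dint.
have mfd : measurable_fun [set: borel L] (fine \o d).
  by apply: measurableT_comp.
have M2 : 0 < 2 * M by rewrite mulr_gt0.
pose N := [set x | 2 * M < fine (d x)].
have mN : measurable N.
  rewrite (_ : N = setT `&` (fine \o d) @^-1` `]2 * M, +oo[).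
    exact: mfd measurableT _ (measurable_itv _).
  by apply/seteqP; split=> x; rewrite /= in_itv/= andbT => // -[].
have muN : mu N = 0%E.
  have : ((2 * M)%:E * mu N <= M%:E * mu N)%E.
    rewrite -integral_cst//; apply: le_trans (rho_le mN).
    rewrite (Radon_Nikodym_SigmaFinite.f_integral rho_mu)//.
    apply: ge0_le_integral => //.
    - by move=> x _; rewrite lee_fin ltW.
    - exact: measurable_funTS.
    - move=> x Nx; rewrite -(fineK (dfin x)) lee_fin; exact: ltW.
  have /fineK <- : mu N \is a fin_num by exact: fin_num_measure.
  have : 0 <= fine (mu N) by rewrite fine_ge0.
  move: (fine (mu N)) => a a0; rewrite -!EFinM lee_fin => aM.
  by congr EFin; nra.
pose h x := Num.min (fine (d x)) (2 * M).
have mh : measurable_fun [set: borel L] h.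
  by apply: measurable_minr.
exists h; split=> // [x|g cg].
  rewrite ger0_norm /h ?ge_min ?lexx ?orbT// le_min (ltW M2) andbT.
  by rewrite fine_ge0.
have mg := cts_measurable cg.
have hd : ae_eq mu setT (EFin \o h) (Radon_Nikodym (charge_of_finite_measure rho) mu).
  apply: ae_eq_trans (ae_eq_Radon_Nikodym_SigmaFinite rho_mu measurableT).
  exists N; split => // x /= /not_implyP[_ hx]; rewrite /N/= ltNge.
  apply/negP => dM; apply: hx; rewrite /h min_l//.
  exact: fineK.
congr fine.
rewrite -(Radon_Nikodym_change_of_variables rho_mu measurableT); last first.
  exact: cts_integrable.
apply: ae_eq_integral => //.
- by apply/measurable_EFinP; exact: measurable_funM.
- by apply: emeasurable_funM => //; exact/measurable_EFinP.
- apply: filterS hd => x /(_ I) /= e _.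
  by rewrite -e -EFinM mulrC.
Qed.

End density.

Section bounded_class.
Context (R : realType) (L : ptopologicalType) (mu : Prob R L).
Context (h : borel L -> measurableTypeR R) (M : R).
Hypotheses (mh : measurable_fun [set: borel L] h) (hM : forall x, `|h x| <= M).

Let hmixin := isMeasurableFun.Build _ _ _ _ _ mh.
Let hm : {mfun borel L >-> measurableTypeR R} :=
  MeasurableFun.Pack (MeasurableFun.Class hmixin).

Let hclass : {mfun_ mu, borel L >-> measurableTypeR R} :=
  (\pi_({mfun_ mu, borel L >-> measurableTypeR R}) hm)%qT.

Let hclass_ae : (hclass : borel L -> measurableTypeR R) = h %[ae mu].
Proof.
by have /eqmodP/asboolP : (repr hclass = hm %[mod {mfun_ mu, borel L >->
  measurableTypeR R}])%qT by exact: reprK.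
Qed.

Let finite_norm_hclass : finite_norm mu +oo%E (hclass : borel L -> R).
Proof.
rewrite /finite_norm unlock /=.
have -> : mu [set: borel L] = 1%E by exact: probability_setT.
rewrite lte01; apply: (@le_lt_trans _ _ M%:E); last exact: ltry.
apply/ess_sup_inf.ess_supP.
by apply: filterS hclass_ae => x /(_ I) /= ->; rewrite lee_fin.
Qed.

Lemma bounded_Linfty : exists u : Linfty mu,
  ((u : {mfun_ mu, borel L >-> measurableTypeR R}) : borel L -> measurableTypeR R)
    = h %[ae mu].
Proof.
pose mix := isFinLebesgue.Build _ _ _ mu _ (leey 1%E) hclass finite_norm_hclass.
by exists (LebesgueSpace.Pack (LebesgueSpace.Class mix)).
Qed.

Lemma normal_representative : normal_measure mu ->
  exists2 c : L -> R, continuous c & ae_eq mu setT (c : borel L -> R) h.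
Proof.
move=> [cL [inv _ invK]]; have [u uh] := bounded_Linfty.
exists (inv u); first exact: cts_fun.
have : (repr (Cclass mu (inv u)) = Cfun (inv u) %[mod {mfun_ mu, borel L >->
  measurableTypeR R}])%qT by exact: reprK.
move=> /eqmodP/asboolP cE.
have e : Cclass mu (inv u) = u :> {mfun_ mu, borel L >-> measurableTypeR R}.
  exact: (congr1 (fun z : Linfty mu =>
    z : {mfun_ mu, borel L >-> measurableTypeR R}) (invK u)).
rewrite e in cE.
by apply: filterS2 cE uh => x /(_ I) /= h1 /(_ I) /= h2 _; exact: etrans (esym h1) h2.
Qed.

End bounded_class.

(** * Continuous conditional expectations and disintegration *)

Section disintegration.
Context (R : realType) (G : groupType) (K L : ptopologicalType).
Context (phi : G -> K -> K) (psi : G -> L -> L) (q : K -> L) (muL : Prob R L).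
Context (muK : Prob R K).
Hypothesis ext : is_extension phi psi q.
Hypothesis fs : fully_supported muL.
Hypothesis lift : pushforward muK (q : borel K -> borel L) ≡B muL.
Implicit Types (f : K -> R) (c g : L -> R).

Let cK := ext_cK ext.
Let hK := ext_hK ext.
Let cL := ext_cL ext.
Let hL := ext_hL ext.
Let cq : continuous q := ext_q ext.
Let stK := integral_state muK cK.
Let stL := integral_state muL cL.

(** Both [c] and the test functions are continuous: under full support this pins
    down [c] everywhere and not only almost everywhere. *)
Definition is_cond_exp (f : K -> R) (c : L -> R) :=
  continuous c /\ forall g : L -> R, continuous g ->
    \int[muL]_l (c l * g l) = \int[muK]_x (f x * g (q x)).

Let ctsq (g : L -> R) : continuous g -> continuous (fun x => g (q x)).
Proof. exact: cts_comp cq. Qed.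

Lemma cond_exp_uniq f c1 c2 : is_cond_exp f c1 -> is_cond_exp f c2 -> c1 = c2.
Proof.
move=> [cc1 e1] [cc2 e2]; apply: (full_support_uniq cL fs) => // g cg.
by rewrite e1 ?e2.
Qed.

Lemma cond_exp_ge0 f c : continuous f -> (forall x, 0 <= f x) ->
  is_cond_exp f c -> forall l, 0 <= c l.
Proof.
move=> cf f0 [cc e]; apply: (full_support_ge0 cL fs) => // g cg g0.
rewrite e//; apply: (state_ge0 stK) => [|x]; first exact: ctsM cf (ctsq cg).
exact: mulr_ge0.
Qed.

Lemma cond_expD f1 f2 c1 c2 : continuous f1 -> continuous f2 ->
  is_cond_exp f1 c1 -> is_cond_exp f2 c2 ->
  is_cond_exp (fun x => f1 x + f2 x) (fun l => c1 l + c2 l).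
Proof.
move=> cf1 cf2 [cc1 e1] [cc2 e2]; split=> [|g cg]; first exact: ctsD.
under eq_Rintegral do rewrite mulrDl.
under [in RHS]eq_Rintegral do rewrite mulrDl.
rewrite (stateD stL) ?(stateD stK) ?e1 ?e2//; try exact: ctsM.
- exact: ctsM cf1 (ctsq cg).
- exact: ctsM cf2 (ctsq cg).
Qed.

Lemma cond_expZ a f c : continuous f -> is_cond_exp f c ->
  is_cond_exp (fun x => a * f x) (fun l => a * c l).
Proof.
move=> cf [cc e]; split=> [|g cg]; first exact: ctsZ.
under eq_Rintegral do rewrite -mulrA.
under [in RHS]eq_Rintegral do rewrite -mulrA.
rewrite (stateZ stL) ?(stateZ stK) ?e//; first exact: ctsM cf (ctsq cg).
exact: ctsM.
Qed.

Lemma cond_exp_base (g : L -> R) : continuous g -> is_cond_exp (fun x => g (q x)) g.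
Proof.
move=> cg; split=> // g' cg'; have cgg : continuous (fun l => g l * g' l).
  exact: ctsM.
exact: (integral_image cK cq lift cgg).
Qed.

Lemma cond_exp_cst a : is_cond_exp (fun=> a) (fun=> a).
Proof. by apply: (@cond_exp_base (fun=> a)); exact: cts_const. Qed.

Lemma cond_exp_integral f c : continuous f -> is_cond_exp f c ->
  \int[muL]_l c l = \int[muK]_x f x.
Proof.
move=> cf [cc /(_ _ (@cts_const R L 1))].
under eq_Rintegral do rewrite mulr1.
by under [in RHS]eq_Rintegral do rewrite mulr1.
Qed.

(** Move the test function to the other side with the inverse of [psi t]. *)
Lemma cond_exp_equivariant t f c : invariant_measures psi muL ->
  invariant_measures phi muK -> continuous f -> is_cond_exp f c ->
  is_cond_exp (fun x => f (phi t x)) (fun l => c (psi t l)).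
Proof.
move=> invL invK cf [cc e].
have ct : continuous (phi t) by exact: (ext_phi ext).
have [cpsi [psi' [cpsi' psiK _]]] := ext_psi ext t.
split=> [|g cg]; first exact: cts_comp cc.
have cg' : continuous (fun l => g (psi' l)) by exact: cts_comp cg.
have ccg : continuous (fun l => c l * g (psi' l)) by exact: ctsM.
have cfg : continuous (fun x => f x * g (psi' (q x))).
  by apply: ctsM => //; exact: ctsq cg'.
transitivity (\int[muL]_l (c l * g (psi' l))).
  rewrite (integral_image cL cpsi (invL t) ccg).
  by apply: eq_Rintegral => l _; rewrite psiK.
rewrite e// (integral_image cK ct (invK t) cfg).
by apply: eq_Rintegral => x _; rewrite (ext_qphi ext) psiK.
Qed.

Section normal.
Hypothesis nmu : normal_measure muL.

(** The state $g \mapsto \int f (g \circ q) d\mu_K$ is integration against a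
    measure with bounded density, and normality makes this density continuous. *)
Lemma cond_exp_exists_pos (f : K -> R) : continuous f -> (forall x, 0 <= f x) ->
  \int[muK]_x f x = 1 -> exists c, is_cond_exp f c.
Proof.
move=> cf f0 f1; pose I (g : L -> R) := \int[muK]_x (f x * g (q x)).
have cfg g : continuous g -> continuous (fun x => f x * g (q x)).
  by move=> cg; exact: ctsM cf (ctsq cg).
have stI : state I.
  split=> [g1 g2 cg1 cg2|a g cg|g cg g0|].
  - rewrite /I -(stateD stK); [|exact: cfg..].
    by apply: eq_Rintegral => x _; rewrite mulrDr.
  - rewrite /I -(stateZ stK); last exact: cfg.
    by apply: eq_Rintegral => x _; rewrite mulrCA.
  - by apply: (state_ge0 stK) => [|x]; [exact: cfg|exact: mulr_ge0].
  - by rewrite -[RHS]f1; apply: eq_Rintegral => x _; rewrite mulr1.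
have [rho rhoE] := riesz_representation cL hL stI.
have [M M0 fM] := cts_bounded cK cf.
have rho_le : forall A : set (borel L), measurable A -> (rho A <= M%:E * muL A)%E.
  apply: regular_le => //; [exact: Prob_regular..|] => g cg g0.
  rewrite rhoE// (integral_image cK cq lift cg) -(stateZ stK); last exact: ctsq.
  apply: (le_state stK) => [||x]; [exact: cfg|exact: ctsZ (ctsq cg)|].
  by rewrite ler_wpM2r// (le_trans (ler_norm _)).
have [h [mh hM hE]] := bounded_density cL M0 rho_le.
have [c cc ch] := normal_representative mh hM nmu.
exists c; split=> // g cg; rewrite -/(I g) -rhoE// -hE//; congr fine.
have mg := cts_measurable cg.
apply: ae_eq_integral => //.
- by apply/measurable_EFinP; exact: cts_measurable (ctsM cc cg).
- by apply/measurable_EFinP; exact: measurable_funM.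
- by apply: filterS ch => x /= e xT; rewrite e.
Qed.

(** An affine change makes [f] positive with integral [1]. *)
Lemma cond_exp_exists (f : K -> R) : continuous f -> exists c, is_cond_exp f c.
Proof.
move=> cf; have [M M0 fM] := cts_bounded cK cf.
have cM := @cts_const R K (M + 1).
have cfM : continuous (fun x => f x + (M + 1)) by exact: ctsD.
have fM1 x : 1 <= f x + (M + 1).
  by have := fM x; rewrite ler_norml => /andP[+ _]; lra.
pose b := \int[muK]_x (f x + (M + 1)).
have b1 : 1 <= b.
  rewrite -[leLHS](state_cst stK); apply: (le_state stK) => //.
  exact: cts_const.
have b0 : b != 0 by rewrite gt_eqF// (lt_le_trans ltr01).
pose f' x := b^-1 * (f x + (M + 1)).
have cf' : continuous f' by exact: ctsZ.
have f'0 x : 0 <= f' x.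
  by rewrite mulr_ge0 ?invr_ge0 ?(le_trans ler01).
have f'1 : \int[muK]_x f' x = 1 by rewrite (stateZ stK)// mulVf.
have [c cE] := cond_exp_exists_pos cf' f'0 f'1.
exists (fun l => b * c l + - (M + 1)).
have -> : f = fun x => b * f' x + - (M + 1).
  by apply/funext => x; rewrite /f' mulrA mulfV// mul1r addrK.
apply: cond_expD; [exact: ctsZ|exact: cts_const|exact: cond_expZ|].
exact: cond_exp_cst.
Qed.

(** The measure $\nu_l$ represents the state $f \mapsto E(f)(l)$; each property of
    a relatively invariant measure is a property of [E] read at the point [l]. *)
Lemma disintegration : invariant_measures psi muL -> invariant_measures phi muK ->
  exists2 nu : L -> Prob R K, RIM R phi psi q nu &
    forall f : K -> R, continuous f ->
      \int[muK]_x f x = \int[muL]_l \int[nu l]_x f x.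
Proof.
move=> invL invK.
have /choice[E EP] (f : K -> R) :
    exists c, continuous f -> is_cond_exp f c.
  have [cf|ncf] := pselect (continuous f); last by exists (fun=> 0).
  by have [c ?] := cond_exp_exists cf; exists c.
have Euniq f c : continuous f -> is_cond_exp f c -> E f = c.
  by move=> cf; apply: cond_exp_uniq (EP f cf).
have stE l : state (fun f => E f l).
  split=> [f g cf cg|a f cf|f cf f0|].
  - by rewrite (Euniq _ _ (ctsD cf cg) (cond_expD cf cg (EP f cf) (EP g cg))).
  - by rewrite (Euniq _ _ (ctsZ cf) (cond_expZ a cf (EP f cf))).
  - exact: cond_exp_ge0 cf f0 (EP f cf) l.
  - by rewrite (Euniq _ _ (@cts_const R K 1) (cond_exp_cst 1)).
have /choice[nu nuE] l := riesz_representation cK hK (stE l).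
have nuq l : pushforward (nu l) (q : borel K -> borel L) ≡B \d_(l : borel L).
  apply: image_eqP => //; [exact: Prob_regular|exact: dirac_regular|] => g cg.
  rewrite Rintegral_dirac// nuE; last exact: ctsq.
  by rewrite (Euniq _ _ (ctsq cg) (cond_exp_base cg)).
exists nu; last first.
  move=> f cf; rewrite -(cond_exp_integral cf (EP f cf)).
  by apply: eq_Rintegral => l _; rewrite nuE.
split=> [l||//|t l]; first by exists l.
  apply/weak_star_cvg => f cf.
  rewrite (_ : (fun l => _) = E f); first exact: (EP f cf).1.
  by apply/funext => l; rewrite nuE.
have ct : continuous (phi t) by exact: (ext_phi ext).
apply: image_eqP => //; [exact: Prob_regular..|] => f cf.
have cft : continuous (fun x => f (phi t x)) by exact: cts_comp cf.
rewrite !nuE//.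
by rewrite (Euniq _ _ cft (cond_exp_equivariant t invL invK cf (EP f cf))).
Qed.

End normal.
End disintegration.

(** * The integral over the base *)

Theorem proposition4p21 (R : realType) (G : groupType) (K L : ptopologicalType)
    (phi : G -> K -> K) (psi : G -> L -> L) (q : K -> L) (muL : Prob R L) :
  is_extension phi psi q ->
  invariant_measures psi muL ->
  fully_supported muL ->
  (exists! I : RIM R phi psi q -> invariant_lifts phi q muL,
     forall nu, is_integral_of muL (set_val nu) (set_val (I nu))) /\
  (forall I : RIM R phi psi q -> invariant_lifts phi q muL,
     (forall nu, is_integral_of muL (set_val nu) (set_val (I nu))) ->
     injective I /\ (normal_measure muL -> bijective I)).
Proof.
move=> ext inv fs.
have cK := ext_cK ext; have hK := ext_hK ext.
have intE (nu : L -> Prob R K) (muK : Prob R K) : is_integral_of muL nu muK ->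
    forall f : K -> R, continuous f ->
      \int[muK]_x f x = \int[muL]_l \int[nu l]_x f x.
  by move=> h f cf; exact: (h (mkcts cf)).
have uniq (nu : L -> Prob R K) (m1 m2 : Prob R K) :
    is_integral_of muL nu m1 -> is_integral_of muL nu m2 -> m1 = m2.
  move=> h1 h2; apply/Prob_eq.
  apply: regular_uniq => //; [exact: Prob_regular..|] => f cf.
  by rewrite (intE _ _ h1)// (intE _ _ h2).
split.
  have /choice[I IP] (nu : RIM R phi psi q) :
      exists muK : invariant_lifts phi q muL,
        is_integral_of muL (set_val nu) (set_val muK).
    have [muK lK e] := RIM_integral_exists ext (set_valP nu) inv.
    exists (SigSub (mem_set lK)) => f; exact: e (@cts_fun _ _ f).
  exists I; split=> // I' I'P; apply/funext => nu; apply: val_inj.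
  exact: uniq (IP nu) (I'P nu).
move=> I IP; have inj : injective I.
  move=> nu1 nu2 e; apply: val_inj.
  apply: (RIM_integral_inj ext fs (set_valP nu1) (set_valP nu2)) => f cf.
  by rewrite -(intE _ _ (IP nu1))// -(intE _ _ (IP nu2))// e.
split=> // nmu.
have /choice[J JP] (muK : invariant_lifts phi q muL) : exists nu, I nu = muK.
  have [invK lift] := set_valP muK.
  have [nu rim e] := disintegration ext fs lift nmu inv invK.
  exists (SigSub (mem_set rim)); apply: val_inj.
  apply: uniq (IP _) _ => f; exact: e (@cts_fun _ _ f).
by exists J => // nu; apply: inj; rewrite JP.
Qed.
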